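(* Let $G$ be a compact Lie group, let $\tau$ be an irreducible (finite-dimensional complex) representation of $G$ whose character $\chi^\tau$ is not real valued, and fix a self-inverse conjugacy class of $G$ with representative $\alpha$. Let $W=\frac{1}{\sqrt2}\left(\chi^\tau(g)+\overline{\chi^\tau(g)}\right)$ and $W'=\frac{1}{\sqrt2}\left(\chi^\tau(\alpha' g)+\overline{\chi^\tau(\alpha' g)}\right)$, where $g$ is chosen from Haar measure on $G$ and, independently, $\alpha'$ is chosen uniformly at random from the conjugacy class of $\alpha$. Let $k$ be a positive integer. Then: (1) $\displaystyle \mathbb{E}\left[(W'-W)^k\right]= \frac{1}{2^{k/2}} \sum_{r=0}^k (-1)^{k-r} \binom{k}{r} \sum_{\phi} m_{\phi}[(\tau+\overline{\tau})^r]\,m_{\phi}[(\tau+\overline{\tau})^{k-r}]\,\frac{\chi^{\phi}(\alpha)}{\dim(\phi)}$; (2) $\displaystyle \mathbb{E}\left[(W'-W)^4\right] = \sum_{\phi}m_{\phi}[(\tau+\overline{\tau})^2]^2 \left[ 2 \left(1-\frac{\chi^{\tau}(\alpha)}{\dim(\tau)} \right) -\frac{3}{2} \left(1 -\frac{\chi^{\phi}(\alpha)}{\dim(\phi)} \right) \right]$. The sums over $\phi$ are over all irreducible representations of $G$.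
   Context: Haar measure is normalized to be a probability measure. A conjugacy class is self-inverse if it contains the inverse of each of its elements. Choosing $\alpha'$ uniformly from the conjugacy class of $\alpha$ means $\alpha'=h\alpha h^{-1}$ with $h$ Haar distributed on $G$. For an irreducible representation $\phi$, $\chi^\phi$ is its character and $\dim(\phi)$ its dimension. $\overline{\tau}$ is the complex conjugate representation of $\tau$, and $m_{\phi}[(\tau+\overline{\tau})^r]$ is the multiplicity of $\phi$ in the $r$-fold tensor product of $\tau\oplus\overline{\tau}$ (which has character $(\chi^{\tau}+\overline{\chi^\tau})^r$; for $r=0$ this is the trivial representation). Sums are over isomorphism classes of irreducible representations. *)

(* Defs.v *)
From HB Require Import structures.
From mathcomp Require Import all_boot all_order all_algebra.
From mathcomp Require Import all_classical all_reals all_analysis.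
From mathcomp Require Import complex mxtens.

Set Implicit Arguments.
Unset Strict Implicit.
Unset Printing Implicit Defensive.

Import Order.TTheory GRing.Theory Num.Theory.
Import numFieldNormedType.Exports.

Local Open Scope classical_set_scope.
Local Open Scope complex_scope.
Local Open Scope ring_scope.

(* Being pointed is no restriction for a group; it is only included because
   g_sigma_algebraType asks for it. *)
HB.mixin Record isTopologicalGroup G of PointedTopological G & Group G := {
  mulg_continuous : continuous (fun p : G * G => (p.1 * p.2)%g);
  invg_continuous : continuous (fun x : G => x^-1%g)
}.

#[short(type="topGroupType")]
HB.structure Definition TopologicalGroup :=
  {G of PointedTopological G & Group G & isTopologicalGroup G}.

Section Smooth.
Variables (R : realType) (V W : normedModType R).

(* On a finite-dimensional V, it is enough that all the iterated directional
   derivatives exist and are continuous. *)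
Fixpoint is_Ck (k : nat) (U : set V) (f : V -> W) : Prop :=
  (forall x, U x -> {for x, continuous f}) /\
  if k is k'.+1 then
    forall v, (forall x, U x -> derivable f x v) /\ is_Ck k' U ('D_v f)
  else True.

Definition smooth_on (U : set V) (f : V -> W) : Prop :=
  forall k, is_Ck k U f.

End Smooth.

Section LieGroup.
Variables (R : realType) (G : topGroupType).

Record chart (n : nat) := Chart {
  chart_dom : set G;
  chart_map : G -> 'rV[R]_n;
  chart_inv : 'rV[R]_n -> G;
  chart_open_dom : open chart_dom;
  chart_open_img : open (chart_map @` chart_dom);
  chart_mapK : forall x, chart_dom x -> chart_inv (chart_map x) = x;
  chart_map_continuous : {within chart_dom, continuous chart_map};
  chart_inv_continuous : {within chart_map @` chart_dom, continuous chart_inv}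
}.

Definition chart_img n (c : chart n) : set 'rV[R]_n :=
  chart_map c @` chart_dom c.

Definition smooth_atlas n (A : set (chart n)) : Prop :=
  (forall x, exists2 c, A c & chart_dom c x) /\
  (forall b c, A b -> A c ->
     smooth_on (chart_map b @` (chart_dom b `&` chart_dom c))
               (chart_map c \o chart_inv b)).

Definition smooth_mul n (A : set (chart n)) : Prop :=
  forall a b c, A a -> A b -> A c ->
    smooth_on [set p : 'rV[R]_n * 'rV[R]_n |
                 [/\ chart_img a p.1, chart_img b p.2
                   & chart_dom c (chart_inv a p.1 * chart_inv b p.2)%g]]
              (fun p => chart_map c (chart_inv a p.1 * chart_inv b p.2)%g).

Definition smooth_inv n (A : set (chart n)) : Prop :=
  forall b c, A b -> A c ->
    smooth_on [set u | chart_img b u /\ chart_dom c (chart_inv b u)^-1%g]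
              (fun u => chart_map c (chart_inv b u)^-1%g).

Definition is_Lie_group : Prop :=
  [/\ hausdorff_space G, @second_countable G
    & exists n, exists A : set (chart n),
        [/\ smooth_atlas A, smooth_mul A & smooth_inv A]].

End LieGroup.

Definition conj_class (G : groupType) (a : G) : set G :=
  [set x | exists h, x = (h * a * h^-1)%g].

Definition self_inverse_class (G : groupType) (C : set G) : Prop :=
  forall x, C x -> C x^-1%g.

Section Haar.
Variables (R : realType) (G : topGroupType).

Definition borel := g_sigma_algebraType (@open G).

(* On a Lie group, which is second countable, a finite Borel measure is
   automatically regular. *)
Definition is_Haar (mu : probability borel R) : Prop :=
  forall (x : G) (A : set G), measurable (A : set borel) ->
    mu [set y : borel | A (x * (y : G))%g] = mu A.

End Haar.

Section RandomElements.
Context {d d1 d2 : measure_display} {Omega : measurableType d}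
  {T1 : measurableType d1} {T2 : measurableType d2} {R : realType}.
Variable P : probability Omega R.

Definition has_law (X : {RV P >-> T1}) (mu : probability T1 R) : Prop :=
  forall A, measurable A -> distribution P X A = mu A.

Definition independent_RV (X : {RV P >-> T1}) (Y : {RV P >-> T2}) : Prop :=
  forall A B, measurable A -> measurable B ->
    P (X @^-1` A `&` Y @^-1` B) = (P (X @^-1` A) * P (Y @^-1` B))%E.

(* The real random variable X has a finite expectation, equal to the (hence
   real) complex number z. *)
Definition has_expectation (X : Omega -> R) (z : R[i]) : Prop :=
  exists2 e : R, 'E_P[X]%E = e%:E & e%:C = z.

End RandomElements.

Section ContinuousComplex.
Variables (R : realType) (T : topologicalType).

(* R[i] carries no topology in the library. *)
Definition Ccontinuous (f : T -> R[i]) : Prop :=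
  continuous (fun x => complex.Re (f x)) /\
  continuous (fun x => complex.Im (f x)).

Lemma Ccontinuous_cst (z : R[i]) : Ccontinuous (fun=> z).
Proof. by split=> x; exact: cvg_cst. Qed.

Lemma CcontinuousM (f g : T -> R[i]) :
  Ccontinuous f -> Ccontinuous g -> Ccontinuous (fun x => f x * g x).
Proof.
move=> [fr fi] [gr gi]; split => x.
- have -> : (fun x => complex.Re (f x * g x)) =
    (fun x => complex.Re (f x) * complex.Re (g x) -
              complex.Im (f x) * complex.Im (g x)).
    by apply/funext => y; case: (f y) => a b; case: (g y).
  by apply: cvgB; apply: cvgM; [exact: fr|exact: gr|exact: fi|exact: gi].
- have -> : (fun x => complex.Im (f x * g x)) =
    (fun x => complex.Re (f x) * complex.Im (g x) +
              complex.Im (f x) * complex.Re (g x)).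
    by apply/funext => y; case: (f y) => a b; case: (g y).
  by apply: cvgD; apply: cvgM; [exact: fr|exact: gi|exact: fi|exact: gr].
Qed.

Lemma CcontinuousJ (f : T -> R[i]) :
  Ccontinuous f -> Ccontinuous (fun x => (f x)^*).
Proof.
move=> [fr fi]; split => x.
- have -> : (fun x => complex.Re (f x)^*) = (fun x => complex.Re (f x)).
    by apply/funext => y; case: (f y).
  exact: fr.
- have -> : (fun x => complex.Im (f x)^*) = (fun x => - complex.Im (f x)).
    by apply/funext => y; case: (f y).
  by apply: cvgN; exact: fi.
Qed.

End ContinuousComplex.

Section Representations.
Variables (R : realType) (G : topGroupType).

Record representation := Representation {
  rdim : nat;
  rmx :> G -> 'M[R[i]]_rdim;
  rmx1 : rmx 1%g = 1%:M;
  rmxM : forall x y, rmx (x * y)%g = rmx x *m rmx y;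
  rmx_continuous : forall i j, Ccontinuous (fun x => rmx x i j)
}.

HB.instance Definition _ := gen_eqMixin representation.
HB.instance Definition _ := gen_choiceMixin representation.

Implicit Types rho sigma phi : representation.

Definition rchar rho (x : G) : R[i] := \tr (rho x).

(* A subspace of column vectors is encoded by the row space of a matrix U whose
   rows are the transposes of the vectors, hence the transposed action. *)
Definition invariant_subspace rho (U : 'M[R[i]]_(rdim rho)) : Prop :=
  forall x, stablemx U (rho x)^T.

Definition irreducible rho : Prop :=
  (0 < rdim rho)%N /\
  forall U, invariant_subspace (rho := rho) U -> U != 0 -> row_full U.

Definition rep_iso rho sigma : Prop :=
  exists (A : 'M[R[i]]_(rdim rho, rdim sigma))
         (B : 'M[R[i]]_(rdim sigma, rdim rho)),
    [/\ A *m B = 1%:M, B *m A = 1%:M & forall x, rho x *m A = A *m sigma x].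

Lemma rep_iso_refl rho : rep_iso rho rho.
Proof.
by exists 1%:M, 1%:M; split=> [||x]; rewrite !(mulmx1, mul1mx).
Qed.

Lemma rep_iso_sym rho sigma : rep_iso rho sigma -> rep_iso sigma rho.
Proof.
move=> [A [B [AB BA comm]]]; exists B, A; split=> // x.
by rewrite -[LHS]mul1mx -BA !mulmxA -(mulmxA B) -comm -!mulmxA AB mulmx1.
Qed.

Lemma rep_iso_trans rho sigma phi :
  rep_iso rho sigma -> rep_iso sigma phi -> rep_iso rho phi.
Proof.
move=> [A [B [AB BA cA]]] [C [D [CD DC cC]]]; exists (A *m C), (D *m B).
split=> [||x]; first by rewrite mulmxA -(mulmxA A) CD mulmx1.
  by rewrite mulmxA -(mulmxA D) BA mulmx1.
by rewrite mulmxA cA -mulmxA cC mulmxA.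
Qed.

Program Definition triv_rep : representation :=
  @Representation 1 (fun=> 1%:M) _ _ _.
Next Obligation. by []. Qed.
Next Obligation. by move=> x y; rewrite mul1mx. Qed.
Next Obligation. by move=> i j; exact: Ccontinuous_cst. Qed.

Program Definition zero_rep : representation :=
  @Representation 0 (fun=> 1%:M) _ _ _.
Next Obligation. by []. Qed.
Next Obligation. by move=> x y; rewrite mul1mx. Qed.
Next Obligation. by case. Qed.

Program Definition conj_rep rho : representation :=
  @Representation (rdim rho) (fun x => map_mx Num.conj (rho x)) _ _ _.
Next Obligation. by move=> rho /=; rewrite rmx1 map_mx1. Qed.
Next Obligation. by move=> rho x y /=; rewrite rmxM map_mxM. Qed.
Next Obligation.
move=> rho i j /=.
under [X in Ccontinuous X]funext do rewrite mxE.
by apply: CcontinuousJ; exact: rmx_continuous.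
Qed.

Program Definition sum_rep rho sigma : representation :=
  @Representation (rdim rho + rdim sigma)
    (fun x => block_mx (rho x) 0 0 (sigma x)) _ _ _.
Next Obligation. by move=> rho sigma /=; rewrite !rmx1 -scalar_mx_block. Qed.
Next Obligation.
move=> rho sigma x y /=.
by rewrite mulmx_block !(mulmx0, mul0mx, addr0, add0r) !rmxM.
Qed.
Next Obligation.
move=> rho sigma i j /=.
case: (split_ordP i) => a ->; case: (split_ordP j) => b ->;
  under [X in Ccontinuous X]funext do
    rewrite ?(block_mxEul, block_mxEur, block_mxEdl, block_mxEdr) ?mxE;
  by [exact: rmx_continuous | exact: Ccontinuous_cst].
Qed.

Program Definition tens_rep rho sigma : representation :=
  @Representation (rdim rho * rdim sigma) (fun x => rho x *t sigma x) _ _ _.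
Next Obligation.
move=> rho sigma /=; rewrite !rmx1; apply/matrixP => i j.
case: (mxtens_indexP i) => a b; case: (mxtens_indexP j) => c e.
rewrite tensmxE !mxE -natrM mulnb; congr (_ %:R); congr nat_of_bool.
by rewrite (can_eq (@mxtens_indexK _ _)) xpair_eqE.
Qed.
Next Obligation. by move=> rho sigma x y /=; rewrite !rmxM tensmx_mul. Qed.
Next Obligation.
move=> rho sigma i j /=.
under [X in Ccontinuous X]funext do rewrite mxE.
by apply: CcontinuousM; exact: rmx_continuous.
Qed.

Definition tens_pow rho (r : nat) : representation :=
  iter r (tens_rep rho) triv_rep.

Definition rep_bigsum (s : seq representation) : representation :=
  foldr sum_rep zero_rep s.

(* The number of summands isomorphic to phi in a decomposition of rho into
   irreducible representations. For compact G a decomposition exists and the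
   number does not depend on it, so the default value of xget is not used. *)
Definition multiplicity phi rho : nat :=
  xget 0%N [set m | exists s : seq representation,
    [/\ forall sigma, sigma \in s -> irreducible sigma,
        rep_iso rho (rep_bigsum s)
      & m = count (fun sigma => `[< rep_iso sigma phi >]) s]].

Definition iso_repr rho : representation :=
  xget triv_rep [set sigma | rep_iso rho sigma].

Lemma iso_reprP rho : rep_iso rho (iso_repr rho).
Proof.
have := @xgetPex _ triv_rep [set sigma | rep_iso rho sigma].
by apply; exists rho; exact: rep_iso_refl.
Qed.

Lemma iso_repr_eq rho sigma : rep_iso rho sigma <-> iso_repr rho = iso_repr sigma.
Proof.
split=> [h|h]; last first.
  apply: (rep_iso_trans (iso_reprP rho)); rewrite h.
  exact/rep_iso_sym/iso_reprP.
rewrite /iso_repr; congr xget; apply/seteqP; split=> phi /=.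
  exact/rep_iso_trans/rep_iso_sym.
exact: rep_iso_trans.
Qed.

(* One representation in each isomorphism class of irreducible ones. This set is
   infinite in general: a sum over it is to be used with finitely many nonzero
   terms only, which is the case when each term contains a multiplicity. *)
Definition Irr : set representation :=
  iso_repr @` [set rho | irreducible rho].

Definition self_conj_sum rho : representation := sum_rep rho (conj_rep rho).

(* The projection Re does not lose anything, see W_statE. *)
Definition W_stat rho (x : G) : R :=
  complex.Re ((Num.sqrt 2)^-1%:C * (rchar rho x + (rchar rho x)^*)).

Lemma W_statE rho x :
  (W_stat rho x)%:C = (Num.sqrt 2)^-1%:C * (rchar rho x + (rchar rho x)^*).
Proof.
rewrite /W_stat; case: (rchar rho x) => a b; apply/eqP.
by rewrite eq_complex /= !mul0r subr0 addr0 subrr mulr0 !eqxx.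
Qed.

End Representations.

Arguments Irr : clear implicits.

(* Main.v *)
(* By Schur orthogonality the mean of chi_rho(a g) chi_sigma(g^-1) is the sum over phi of
   m_phi(rho) m_phi(sigma) chi_phi(a) / dim phi, which depends only on the
   conjugacy class of a. So after Fubini the average over alpha' is trivial, and
   (1) is the binomial expansion of (W' - W)^k together with the fact that the
   character X of tau + conj tau satisfies X(g^-1) = X(g).
   For (2), the constituents of tau + conj tau are tau and its conjugate, on both
   of which the normalized character takes the same value at alpha, since
   chi_tau(alpha) is real. Hence the mean of X(alpha g) X(g)^3 is
   chi_tau(alpha) / dim tau times the mean of X^4, which also equals the sum
   of the m_phi[(tau + conj tau)^2]^2. *)
Require Import Defs.
From HB Require Import structures.
From mathcomp Require Import all_boot all_order all_algebra.
From mathcomp Require Import all_classical all_reals all_analysis.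
From mathcomp Require Import complex mxtens measurable_realfun ring.

Set Implicit Arguments.
Unset Strict Implicit.
Unset Printing Implicit Defensive.

Import Order.TTheory GRing.Theory Num.Theory.
Import numFieldNormedType.Exports.

Local Open Scope classical_set_scope.
Local Open Scope complex_scope.
Local Open Scope ring_scope.

(** * Integration of continuous functions against Haar measure *)

Lemma continuous_compact_bounded (R : realType) (T : topologicalType)
    (f : T -> R) :
  compact [set: T] -> continuous f ->
  exists2 M : R, 0 < M & forall x, `|f x| <= M.
Proof.
move=> cT cf.
have /compact_bounded[M [_ hM]] : compact (f @` [set: T]).
  by apply: continuous_compact => //; exact: continuous_subspaceT.
exists (`|M| + 1); first by rewrite ltr_wpDl.
move=> x; apply: (hM (`|M| + 1)); last by exists x.
by rewrite ltr_pwDr// ler_norm.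
Qed.

Lemma continuous_measurable_borel (R : realType) (G : topGroupType)
    (f : G -> R) :
  continuous f -> measurable_fun [set: borel G] (f : borel G -> R).
Proof.
move=> cf; apply: (measurability _ (RGenOInfty.measurableE R)) => _ [_ [a ->] <-].
rewrite setTI; apply: sub_sigma_algebra => /=.
by apply: open_comp => [x _|]; [exact: cf | exact: interval_open].
Qed.

Lemma continuous_fun_measurable (G : topGroupType) (f : G -> G) :
  continuous f -> measurable_fun [set: borel G] (f : borel G -> borel G).
Proof.
move=> cf; apply: (@measurability _ _ (borel G) (borel G) _ _ (@open G)) => //.
move=> _ [A oA <-].
rewrite setTI; apply: sub_sigma_algebra => /=.
by apply: open_comp => [x _|//]; exact: cf.
Qed.

(** * Continuous functions with complex or matrix values *)

Section ContinuousComplexTheory.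
Variables (R : realType) (T : topologicalType).
Implicit Types f g : T -> R[i].

Lemma CcontinuousD f g :
  Ccontinuous f -> Ccontinuous g -> Ccontinuous (fun x => f x + g x).
Proof.
move=> [fr fi] [gr gi]; split => x.
- under [X in continuous_at _ X]funext do rewrite raddfD.
  exact: continuousD (fr x) (gr x).
- under [X in continuous_at _ X]funext do rewrite raddfD.
  exact: continuousD (fi x) (gi x).
Qed.

Lemma Ccontinuous_sum (I : Type) (s : seq I) (P : pred I) (F : I -> T -> R[i]) :
  (forall i, Ccontinuous (F i)) -> Ccontinuous (fun x => \sum_(i <- s | P i) F i x).
Proof.
move=> cF; elim: s => [|i s ih].
  by under [X in Ccontinuous X]funext do rewrite big_nil; exact: Ccontinuous_cst.
under [X in Ccontinuous X]funext do rewrite big_cons.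
by case: (P i) => //; exact: CcontinuousD.
Qed.

Lemma CcontinuousX f n : Ccontinuous f -> Ccontinuous (fun x => f x ^+ n).
Proof.
move=> cf; elim: n => [|n ih]; first exact: Ccontinuous_cst.
by under [X in Ccontinuous X]funext do rewrite exprS; exact: CcontinuousM.
Qed.

Lemma Ccontinuous_comp (S : topologicalType) (h : S -> T) f :
  continuous h -> Ccontinuous f -> Ccontinuous (f \o h).
Proof.
move=> ch [fr fi]; split => x.
- exact: (@continuous_comp _ _ _ h (fun y => complex.Re (f y)) x (ch x) (fr _)).
- exact: (@continuous_comp _ _ _ h (fun y => complex.Im (f y)) x (ch x) (fi _)).
Qed.

Definition mxcontinuous m n (F : T -> 'M[R[i]]_(m, n)) :=
  forall i j, Ccontinuous (fun x => F x i j).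

Lemma mxcontinuous_cst m n (A : 'M[R[i]]_(m, n)) : mxcontinuous (fun=> A).
Proof. by move=> i j; exact: Ccontinuous_cst. Qed.

Lemma mxcontinuousM m n p (F : T -> 'M[R[i]]_(m, n)) (H : T -> 'M[R[i]]_(n, p)) :
  mxcontinuous F -> mxcontinuous H -> mxcontinuous (fun x => F x *m H x).
Proof.
move=> cF cH i j.
under [X in Ccontinuous X]funext do rewrite mxE.
by apply: Ccontinuous_sum => k; exact: CcontinuousM.
Qed.

Lemma Ccontinuous_trace n (F : T -> 'M[R[i]]_n) :
  mxcontinuous F -> Ccontinuous (fun x => \tr (F x)).
Proof. by move=> cF; apply: Ccontinuous_sum. Qed.

End ContinuousComplexTheory.

Section GroupContinuity.
Variable G : topGroupType.

Lemma mulgl_continuous (a : G) : continuous (fun x : G => (a * x)%g).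
Proof.
move=> x.
apply: (@continuous_comp _ _ _ (fun x : G => (a, x)) (fun p : G * G => (p.1 * p.2)%g)).
  by apply: cvg_pair => //; exact: cvg_cst.
exact: mulg_continuous.
Qed.

Lemma conjgV_continuous (a : G) : continuous (fun x : G => (x * a * x^-1)%g).
Proof.
move=> x.
apply: (@continuous_comp _ _ _ (fun x : G => ((x * a)%g, x^-1%g)) (fun p : G * G => (p.1 * p.2)%g)).
  apply: cvg_pair; last exact: invg_continuous.
  apply: (@continuous_comp _ _ _ (fun x : G => (x, a)) (fun p : G * G => (p.1 * p.2)%g)).
    by apply: cvg_pair => //; exact: cvg_cst.
  exact: mulg_continuous.
exact: mulg_continuous.
Qed.

End GroupContinuity.

Lemma bounded_integrable (R : realType) (d : measure_display)
    (T : measurableType d) (P : probability T R) (f : T -> R) (M : R) :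
  measurable_fun [set: T] f -> (forall x, `|f x| <= M) ->
  P.-integrable [set: T] (EFin \o f).
Proof.
move=> mf fM; apply: measurable_bounded_integrable => //.
  by rewrite [ltLHS]probability_setT ltry.
exists M; split; first exact: num_real.
by move=> y My x _; exact: le_trans (fM x) (ltW My).
Qed.

(** * The Haar integral of complex and matrix functions *)

Section HaarIntegral.
Variables (R : realType) (G : topGroupType) (mu : probability (borel G) R).
Hypotheses (compactG : compact [set: G]) (haar_mu : is_Haar mu).
Implicit Types f g : G -> R[i].

Let mu_setT : mu [set: borel G] = 1%E.
Proof. exact: probability_setT. Qed.

Lemma continuous_integrable (f : G -> R) :
  continuous f -> mu.-integrable [set: borel G] (EFin \o (f : borel G -> R)).
Proof.
move=> cf; have [M _ fM] := continuous_compact_bounded compactG cf.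
apply: (@bounded_integrable _ _ _ mu f M) fM.
exact: continuous_measurable_borel.
Qed.

(** Compactness makes both parts of a [Ccontinuous] function integrable, so the rules below ask at
    most for [Ccontinuous]. *)
Definition Cintegral f : R[i] :=
  (Rintegral mu [set: borel G] (fun x => complex.Re (f x))) +i*
  (Rintegral mu [set: borel G] (fun x => complex.Im (f x))).

Lemma Cintegral_real (f : G -> R) :
  Cintegral (fun x => (f x)%:C) = (Rintegral mu [set: borel G] f)%:C.
Proof.
by rewrite /Cintegral /= Rintegral_cst// mul0r.
Qed.

Lemma Cintegral_cst c : Cintegral (fun=> c) = c.
Proof.
rewrite /Cintegral !Rintegral_cst// ![X in fine X]mu_setT !mulr1.
by case: c.
Qed.

Lemma CintegralD f g : Ccontinuous f -> Ccontinuous g ->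
  Cintegral (fun x => f x + g x) = Cintegral f + Cintegral g.
Proof.
move=> [fr fi] [gr gi]; rewrite /Cintegral.
under eq_Rintegral do rewrite raddfD.
rewrite RintegralD//=; try exact: continuous_integrable.
under [X in _ +i* X]eq_Rintegral do rewrite raddfD.
by rewrite RintegralD//=; try exact: continuous_integrable.
Qed.

Lemma CintegralZ c f : Ccontinuous f ->
  Cintegral (fun x => c * f x) = c * Cintegral f.
Proof.
case: c => a b [fr fi]; rewrite /Cintegral.
have iZ (h : G -> R) (e : R) : continuous h ->
    mu.-integrable [set: borel G] (EFin \o ((fun x => e * h x) : borel G -> R)).
  by move=> ch; apply: continuous_integrable => x; apply: cvgM; [exact: cvg_cst|exact: ch].
have -> : (fun x => complex.Re ((a +i* b) * f x)) =
    (fun x => a * complex.Re (f x) - b * complex.Im (f x)).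
  by apply/funext => x; case: (f x).
have -> : (fun x => complex.Im ((a +i* b) * f x)) =
    (fun x => a * complex.Im (f x) + b * complex.Re (f x)).
  by apply/funext => x; case: (f x).
rewrite RintegralB//=; try exact: iZ.
rewrite RintegralD//=; try exact: iZ.
by rewrite !RintegralZl//; exact: continuous_integrable.
Qed.

Lemma Cintegral_sum (I : Type) (s : seq I) (P : pred I) (F : I -> G -> R[i]) :
  (forall i, Ccontinuous (F i)) ->
  Cintegral (fun x => \sum_(i <- s | P i) F i x) =
  \sum_(i <- s | P i) Cintegral (F i).
Proof.
move=> cF; elim: s => [|i s ih].
  rewrite big_nil -[RHS](Cintegral_cst 0); congr Cintegral.
  by apply/funext => x; rewrite big_nil.
rewrite big_cons -ih.
under [X in Cintegral X]funext do rewrite big_cons.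
by case: (P i) => //; rewrite CintegralD//; exact: Ccontinuous_sum.
Qed.

(** Left invariance says that $x \mapsto ax$ pushes [mu] forward to itself; the rest is change of
    variables. *)
Lemma Rintegral_translate (f : G -> R) (a : G) : continuous f ->
  Rintegral mu [set: borel G] (fun x => f (a * (x : G))%g) =
  Rintegral mu [set: borel G] f.
Proof.
move=> cf; rewrite /Rintegral; congr fine.
have ma : measurable_fun [set: borel G] (fun x : borel G => (a * (x : G))%g : borel G).
  by apply: continuous_fun_measurable => x; exact: mulgl_continuous.
transitivity (\int[pushforward mu (fun x : borel G => (a * (x : G))%g : borel G)]_y
   (f (y : G))%:E)%E.
  rewrite (integral_pushforward ma)//=.
    apply/measurable_EFinP; exact: continuous_measurable_borel.
  apply: (@continuous_integrable (f \o (fun x => (a * x)%g))) => x.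
  by apply: continuous_comp; [exact: mulgl_continuous|exact: cf].
apply: eq_measure_integral => A mA _.
exact: haar_mu.
Qed.

Lemma Cintegral_translate f (a : G) : Ccontinuous f ->
  Cintegral (fun x => f (a * x)%g) = Cintegral f.
Proof.
move=> [fr fi]; rewrite /Cintegral.
rewrite (Rintegral_translate (f := fun x => complex.Re (f x)))//.
by rewrite (Rintegral_translate (f := fun x => complex.Im (f x))).
Qed.

(** By compactness the real part attains a positive minimum, a lower bound for its integral because
    [mu] has mass 1. This serves to show that an averaged Hermitian form is definite. *)
Lemma Cintegral_gt0 f : Ccontinuous f -> (forall x, 0 < f x) -> Cintegral f != 0.
Proof.
move=> [fr fi] f0.
have [c _ cmin] : exists2 c : G, c \in [set: G] &
    forall t, t \in [set: G] -> complex.Re (f c) <= complex.Re (f t).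
  apply: compact_EVT_min => //; first by exists 1%g.
  exact: continuous_subspaceT.
have c0 : 0 < complex.Re (f c) by move: (f0 c); rewrite ltcE => /andP[].
apply/eqP => /(congr1 (@complex.Re R)) /= h.
suff : complex.Re (f c) <= 0 by rewrite leNgt c0.
rewrite -h -[leLHS](_ : Rintegral mu [set: borel G] (fun=> complex.Re (f c)) = _).
  apply: le_Rintegral => //.
  - by apply: continuous_integrable => ?; exact: cvg_cst.
  - exact: continuous_integrable.
  - by move=> x _; apply: cmin; rewrite inE.
by rewrite Rintegral_cst// [X in fine X]mu_setT mulr1.
Qed.

Definition mxintegral m n (F : G -> 'M[R[i]]_(m, n)) : 'M[R[i]]_(m, n) :=
  \matrix_(i, j) Cintegral (fun x => F x i j).

Lemma mxintegral_mulmx m n p q (A : 'M[R[i]]_(m, n)) (B : 'M[R[i]]_(p, q))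
    (F : G -> 'M[R[i]]_(n, p)) :
  mxcontinuous F -> mxintegral (fun x => A *m F x *m B) = A *m mxintegral F *m B.
Proof.
move=> cF; apply/matrixP => i j; rewrite !mxE.
transitivity (Cintegral (fun x => \sum_k \sum_l (A i l * B k j) * F x l k)).
  congr Cintegral; apply/funext => x; rewrite mxE; apply: eq_bigr => k _.
  by rewrite !mxE big_distrl; apply: eq_bigr => l _; rewrite /= mulrAC.
have cA k l : Ccontinuous (fun x => A i l * B k j * F x l k).
  by apply: CcontinuousM => //; exact: Ccontinuous_cst.
rewrite Cintegral_sum; last by move=> k; apply: Ccontinuous_sum => l.
apply: eq_bigr => k _; rewrite Cintegral_sum//.
rewrite !mxE big_distrl; apply: eq_bigr => l _ /=.
by rewrite CintegralZ// mxE mulrAC.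
Qed.

Lemma mxintegral_translate m n (F : G -> 'M[R[i]]_(m, n)) a :
  mxcontinuous F -> mxintegral (fun x => F (a * x)%g) = mxintegral F.
Proof.
move=> cF; apply/matrixP => i j; rewrite !mxE.
exact: (Cintegral_translate (f := fun x => F x i j)).
Qed.

Lemma mxtrace_mxintegral n (F : G -> 'M[R[i]]_n) :
  mxcontinuous F -> \tr (mxintegral F) = Cintegral (fun x => \tr (F x)).
Proof.
by move=> cF; rewrite Cintegral_sum//; apply: eq_bigr => i _; rewrite mxE.
Qed.

End HaarIntegral.

(** * Schur's lemma and orthogonality of characters *)

Section Schur.
Variables (R : realType) (G : topGroupType).
Implicit Types rho sigma phi psi : representation R G.

Lemma rmxV rho x : rho x^-1%g *m rho x = 1%:M.
Proof. by rewrite -rmxM mulVg rmx1. Qed.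

Lemma rmxVr rho x : rho x *m rho x^-1%g = 1%:M.
Proof. by rewrite -rmxM mulgV rmx1. Qed.

Lemma rchar_iso rho sigma : rep_iso rho sigma -> rchar rho =1 rchar sigma.
Proof.
move=> [A [B [AB BA cA]]] x; rewrite /rchar.
by rewrite -[rho x]mulmx1 -AB mulmxA cA mxtrace_mulC mulmxA BA mul1mx.
Qed.

Lemma rdim_iso rho sigma : rep_iso rho sigma -> rdim rho = rdim sigma.
Proof.
move=> [A [B [AB BA _]]]; apply/eqP; rewrite eqn_leq.
have := mxrankM_maxl A B; have := mxrankM_maxl B A.
rewrite AB BA !mxrank1 => h1 h2; rewrite (leq_trans h2 (rank_leq_col A)).
exact: leq_trans h1 (rank_leq_col B).
Qed.

(** The column space of [T] is stable under [rho] and its kernel under [sigma]. As [T] is nonzero,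
    irreducibility makes the former everything and the latter zero. Transposes appear because
    subspaces are encoded by row spaces. *)
Lemma schur rho sigma (T : 'M[R[i]]_(rdim rho, rdim sigma)) :
  irreducible rho -> irreducible sigma ->
  (forall x, rho x *m T = T *m sigma x) -> T != 0 ->
  exists S, T *m S = 1%:M /\ S *m T = 1%:M.
Proof.
move=> [_ irho] [_ isigma] cT T0.
have fullT : row_full <<T^T>>%MS.
  apply: irho => [x|]; last by rewrite -mxrank_eq0 genmxE mxrank_eq0 trmx_eq0.
  rewrite genmxE (eqmxMr _ (genmxE _)) -trmx_mul cT trmx_mul.
  exact: submxMl.
have freeT : row_free T^T.
  rewrite -kermx_eq0; apply: contraNT T0 => k0.
  have /row_fullP[B Bk] : row_full (kermx T^T).
    apply: isigma => // x; apply/sub_kermxP.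
    by rewrite -mulmxA -trmx_mul -cT trmx_mul mulmxA mulmx_ker mul0mx.
  by rewrite -trmx_eq0 -[T^T]mul1mx -Bk -mulmxA mulmx_ker mulmx0.
move: fullT; rewrite /row_full genmxE => /row_fullP[B BT].
have /row_freeP[S TS] := freeT.
have BS : B = S by rewrite -[B]mulmx1 -TS mulmxA BT mul1mx.
exists B^T; split; apply: trmx_inj; rewrite trmx_mul trmxK trmx1 //.
by rewrite BS.
Qed.

(** [T] has an eigenvalue $c$ since [R[i]] is algebraically closed and the dimension is positive;
    $T-c$ is then a singular intertwiner, hence zero. *)
Lemma schur_scalar rho (T : 'M[R[i]]_(rdim rho)) :
  irreducible rho -> (forall x, rho x *m T = T *m rho x) ->
  exists c, T = c%:M.
Proof.
move=> irho cT.
have /closed_rootP[c] : size (char_poly T) != 1%N.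
  by rewrite size_char_poly eqSS -lt0n; case: irho.
rewrite -eigenvalue_root_char => /eigenvalueP[v vT v0]; exists c.
apply/eqP; rewrite -subr_eq0; apply/negPn/negP => Tc0.
have [x|S [TS _]] := schur irho irho _ Tc0.
  by rewrite mulmxBr mulmxBl cT scalar_mxC.
move: v0; rewrite -[v]mulmx1 -TS mulmxA mulmxBr vT mul_mx_scalar subrr mul0mx.
by rewrite eqxx.
Qed.

End Schur.

(** * Haar averages of matrices and orthogonality of characters *)

Section Orthogonality.
Variables (R : realType) (G : topGroupType) (mu : probability (borel G) R).
Hypotheses (compactG : compact [set: G]) (haar_mu : is_Haar mu).
Implicit Types rho sigma phi psi : representation R G.

Lemma rmxV_continuous rho : mxcontinuous (fun x => rho x^-1%g).
Proof.
move=> i j; apply: (@Ccontinuous_comp _ _ _ (fun x : G => x^-1%g) (fun x => rho x i j)).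
  exact: invg_continuous.
exact: rmx_continuous.
Qed.

Lemma rmx_mxcontinuous rho : mxcontinuous (fun x => rho x).
Proof. exact: rmx_continuous. Qed.

Definition intertwiner_mean rho sigma (A : 'M[R[i]]_(rdim rho, rdim sigma)) :=
  mxintegral mu (fun g => rho g *m A *m sigma g^-1%g).

Lemma conj_mxcontinuous rho sigma (A : 'M[R[i]]_(rdim rho, rdim sigma)) :
  mxcontinuous (fun g => rho g *m A *m sigma g^-1%g).
Proof.
apply: mxcontinuousM; last exact: rmxV_continuous.
by apply: mxcontinuousM; [exact: rmx_mxcontinuous|exact: mxcontinuous_cst].
Qed.

(** Replacing $g$ by $xg$ leaves the mean unchanged, but multiplies it by $\rho(x)$ on the left and
    $\sigma(x)^{-1}$ on the right. *)
Lemma intertwiner_meanC rho sigma (A : 'M[R[i]]_(rdim rho, rdim sigma)) x :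
  rho x *m intertwiner_mean A = intertwiner_mean A *m sigma x.
Proof.
rewrite -[LHS]mulmx1 -(rmxV sigma x) mulmxA; congr (_ *m _).
rewrite -(mxintegral_mulmx mu compactG _ _ (conj_mxcontinuous A)).
rewrite -[RHS](mxintegral_translate compactG haar_mu x (conj_mxcontinuous A)).
by congr mxintegral; apply/funext => g; rewrite invgM !rmxM !mulmxA.
Qed.

(** Schur orthogonality in convolution form: the integral is a sum of entries of averaged
    intertwiners, each of which is zero or, after identifying [psi] with [phi], a scalar known from
    its trace. *)
Lemma rchar_conv phi psi (a : G) : irreducible phi -> irreducible psi ->
  Cintegral mu (fun g => rchar phi (a * g)%g * rchar psi g^-1%g) =
  if `[< rep_iso phi psi >] then rchar phi a / (rdim phi)%:R else 0.
Proof.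
move=> iphi ipsi.
(* The product $\phi(ag)_{ii}\,\sigma(g^{-1})_{kk}$ is the $(i,k)$ entry of
   $\phi(a)\phi(g)E_{ik}\sigma(g^{-1})$. *)
have conv sigma : Cintegral mu (fun g => rchar phi (a * g)%g * rchar sigma g^-1%g) =
    \sum_i \sum_k (phi a *m intertwiner_mean (delta_mx i k : 'M[R[i]]_(_, rdim sigma))) i k.
  have cM i k : mxcontinuous (fun g => phi a *m
      (phi g *m (delta_mx i k : 'M[R[i]]_(_, rdim sigma)) *m sigma g^-1%g)).
    by apply: mxcontinuousM; [exact: mxcontinuous_cst|exact: conj_mxcontinuous].
  transitivity (Cintegral mu (fun g => \sum_i \sum_k
      (phi a *m (phi g *m (delta_mx i k : 'M[R[i]]_(_, rdim sigma)) *m sigma g^-1%g)) i k)).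
    congr Cintegral; apply/funext => g; rewrite /rchar rmxM /mxtrace big_distrl.
    apply: eq_bigr => i _; rewrite big_distrr; apply: eq_bigr => k _ /=.
    rewrite !mulmxA -rmxM mxE (bigD1 k)//= big1 ?addr0 => [|l lk].
      by rewrite mxE (bigD1 i)//= big1 ?addr0 => [|j ji]; rewrite mxE ?eqxx ?mulr1 //
        (negPf ji) mulr0.
    by rewrite mxE big1 ?mul0r// => j _; rewrite mxE (negPf lk) andbF mulr0.
  rewrite Cintegral_sum//; last by move=> i; apply: Ccontinuous_sum => k; exact: cM.
  apply: eq_bigr => i _; rewrite Cintegral_sum//; last by move=> k; exact: cM.
  apply: eq_bigr => k _; rewrite -[phi a *m _]mulmx1.
  rewrite -(mxintegral_mulmx mu compactG _ _ (conj_mxcontinuous _)).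
  by rewrite mxE; congr Cintegral; apply/funext => g; rewrite mulmx1.
case: asboolP => [pp|npp]; last first.
  rewrite conv big1// => i _; rewrite big1// => k _.
  rewrite (_ : intertwiner_mean _ = 0) ?mulmx0 ?mxE//.
  apply/eqP/negPn/negP => T0; apply: npp.
  have [S [TS ST]] := schur iphi ipsi (@intertwiner_meanC _ _ (delta_mx i k)) T0.
  by exists (intertwiner_mean (delta_mx i k)), S; split=> // x; exact: intertwiner_meanC.
under [X in Cintegral _ X]funext do rewrite -(rchar_iso pp).
have d0 : (rdim phi)%:R != 0 :> R[i] by rewrite pnatr_eq0 -lt0n; case: iphi.
rewrite conv /rchar [\tr _ / _]big_distrl; apply: eq_bigr => i _ /=.
(* Conjugation preserves the trace of $E_{ik}$, so the scalar is $1/\dim\phi$ for $i=k$ and $0$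
   otherwise. *)
have trT k : \tr (intertwiner_mean (delta_mx i k : 'M[R[i]]_(_, rdim phi))) = (i == k)%:R.
  rewrite mxtrace_mxintegral//; last exact: conj_mxcontinuous.
  rewrite -[RHS](Cintegral_cst mu); congr Cintegral; apply/funext => g.
  rewrite mxtrace_mulC mulmxA rmxV mul1mx /mxtrace.
  case: eqVneq => [->|ik].
    by rewrite (bigD1 k)//= big1 ?mxE ?eqxx ?addr0// => j jk; rewrite mxE (negPf jk).
  by rewrite big1// => j _; rewrite mxE; case: eqVneq => // ->; rewrite (negPf ik).
rewrite (bigD1 i)//= big1 ?addr0 => [|k ki].
  have [c Tc] := schur_scalar iphi (@intertwiner_meanC _ _ (delta_mx i i)).
  have := trT i; rewrite Tc mxtrace_scalar eqxx -(mulr_natr c) => cd.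
  by rewrite mul_mx_scalar mxE mulrC (canRL (mulfK d0) cd) mul1r.
have [c Tc] := schur_scalar iphi (@intertwiner_meanC _ _ (delta_mx i k)).
have := trT k; rewrite Tc mxtrace_scalar eq_sym (negPf ki) -(mulr_natr c) => /eqP.
by rewrite mulf_eq0 (negPf d0) orbF => /eqP ->; rewrite mul_mx_scalar scale0r mxE.
Qed.

(* K, the mean of rho g (rho g)^*, is an invertible matrix that intertwines
   rho and its contragredient conjugate. *)
Lemma rcharV rho x : rchar rho x^-1%g = (rchar rho x)^*.
Proof.
pose H n m (M : 'M[R[i]]_(n, m)) : 'M[R[i]]_(m, n) := (map_mx Num.conj M)^T.
have HM n m p (M : 'M[R[i]]_(n, m)) (N : 'M[R[i]]_(m, p)) : H _ _ (M *m N) = H _ _ N *m H _ _ M.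
  by rewrite /H map_mxM trmx_mul.
have cH : mxcontinuous (fun g => H _ _ (rho g)).
  move=> i j; rewrite /H.
  under [X in Ccontinuous X]funext do rewrite !mxE.
  by apply: CcontinuousJ; exact: rmx_continuous.
have cF : mxcontinuous (fun g => rho g *m H _ _ (rho g)).
  by apply: mxcontinuousM => //; exact: rmx_mxcontinuous.
pose K := mxintegral mu (fun g => rho g *m H _ _ (rho g)).
have invK y : rho y *m K *m H _ _ (rho y) = K.
  rewrite -(mxintegral_mulmx mu compactG _ _ cF).
  rewrite -[RHS](mxintegral_translate compactG haar_mu y cF).
  by congr mxintegral; apply/funext => g; rewrite rmxM HM !mulmxA.
(* If $vK=0$ with $v\neq0$, then the mean of $|v\rho(g)|^2$ vanishes, although the integrand is
   positive everywhere because $\rho(g)$ is invertible. *)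
have Kunit : K \in unitmx.
  rewrite -row_free_unit -kermx_eq0; apply/rowV0P => v /sub_kermxP vK.
  apply/eqP/negPn/negP => v0.
  have : \tr (v *m K *m H _ _ v) = 0 by rewrite vK mul0mx mxtrace0.
  rewrite -(mxintegral_mulmx mu compactG _ _ cF) mxtrace_mxintegral//; last first.
    by apply: mxcontinuousM; [apply: mxcontinuousM => //|]; exact: mxcontinuous_cst.
  apply/eqP/Cintegral_gt0 => //.
    by apply: Ccontinuous_trace; apply: mxcontinuousM; [apply: mxcontinuousM => //|];
      exact: mxcontinuous_cst.
  move=> g; rewrite mulmxA -mulmxA -HM /mxtrace big_ord1.
  have [j wj] : exists j, (v *m rho g) 0 j != 0.
    apply/rV0Pn; apply: contra v0 => /eqP vg.
    by rewrite -[v]mulmx1 -(rmxVr rho g) mulmxA vg mul0mx.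
  move: (v *m rho g) wj => w wj; rewrite mxE (bigD1 j)//= ltr_pwDl//.
    by rewrite /H !mxE mul_conjC_gt0.
  by apply: sumr_ge0 => k _; rewrite /H !mxE mul_conjC_ge0.
(* From $K=\rho(x)K\rho(x)^*$: thus $\rho(x)$ is similar to $\rho(x^{-1})^*$ and has the same
   trace. *)
have eK : rho x *m K = K *m H _ _ (rho x^-1%g).
  rewrite -{2}(invK x) -!mulmxA -HM rmxV [H _ _ 1%:M](_ : _ = 1%:M) ?mulmx1//.
  by rewrite /H map_mx1 trmx1.
have : rchar rho x = \tr (H _ _ (rho x^-1%g)).
  by rewrite /rchar -[rho x](mulmxK Kunit) eK mxtrace_mulC mulmxA mulVmx// mul1mx.
rewrite /H mxtrace_tr => ->.
have -> : \tr (map_mx Num.conj (rho x^-1%g)) = Num.conj (rchar rho x^-1%g).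
  by rewrite /rchar /mxtrace rmorph_sum; apply: eq_bigr => i _; rewrite mxE.
by rewrite conjCK.
Qed.

End Orthogonality.

(** * Complete reducibility and multiplicities *)

Section Maschke.
Variables (R : realType) (G : topGroupType) (mu : probability (borel G) R).
Hypotheses (compactG : compact [set: G]) (haar_mu : is_Haar mu).
Implicit Types rho sigma phi psi : representation R G.

Lemma exists_minimal_invariant rho : (0 < rdim rho)%N ->
  exists U : 'M[R[i]]_(rdim rho), [/\ invariant_subspace (rho := rho) U, U != 0 &
    forall V, invariant_subspace (rho := rho) V -> V != 0 -> (\rank U <= \rank V)%N].
Proof.
move=> d0.
pose Pr r := `[< exists U : 'M[R[i]]_(rdim rho),
  [/\ invariant_subspace (rho := rho) U, U != 0 & \rank U = r] >].
have exP : exists r, Pr r.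
  exists (rdim rho); apply/asboolP; exists 1%:M; split; last exact: mxrank1.
    by move=> x; rewrite mul1mx submx1.
  by rewrite -mxrank_eq0 mxrank1 -lt0n.
have [r /asboolP[U [iU U0 rU]] rmin] := ex_minnP exP.
exists U; split=> // V iV V0; rewrite rU; apply: rmin.
by apply/asboolP; exists V.
Qed.

(** Averaging any projection onto an invariant subspace gives an equivariant map that still fixes
    the subspace and still maps into it. *)
Lemma exists_equivariant_projection rho (U : 'M[R[i]]_(rdim rho)) :
  invariant_subspace (rho := rho) U ->
  exists P : 'M[R[i]]_(rdim rho),
    [/\ forall x, rho x *m P = P *m rho x, P *m P = P & (P^T :=: U)%MS].
Proof.
(* A projection onto the row space of [U], transposed to act on columns. *)
move=> iU; pose p0 := (pinvmx U *m U)^T.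
pose P := intertwiner_mean mu p0; exists P.
have cp : mxcontinuous (fun g => rho g *m p0 *m rho g^-1%g).
  exact: conj_mxcontinuous.
have p0U (V : 'M[R[i]]_(rdim rho)) : (V <= U)%MS -> p0 *m V^T = V^T.
  by move=> VU; rewrite /p0 -trmx_mul mulmxA mulmxKpV.
have mx_cst m n (A : 'M[R[i]]_(m, n)) : mxintegral mu (fun=> A) = A.
  by apply/matrixP => i j; rewrite mxE Cintegral_cst.
(* Each conjugate $\rho(g)p_0\rho(g)^{-1}$ fixes [U], since $\rho(g)^{-1}$ maps [U] into itself,
   where $p_0$ is the identity. *)
have UP : U *m P^T = U.
  apply: trmx_inj; rewrite trmx_mul trmxK -[LHS]mul1mx mulmxA.
  rewrite -(mxintegral_mulmx mu compactG _ _ cp) -[RHS]mx_cst.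
  congr mxintegral; apply/funext => g; rewrite mul1mx -!mulmxA.
  rewrite -{1}[rho g^-1%g]trmxK -trmx_mul p0U; last exact: iU.
  by rewrite trmx_mul trmxK mulmxA rmxVr mul1mx.
(* Each conjugate has image in $\rho(g)U \subseteq U$; containment is tested by a linear condition,
   the cokernel of [U], which passes through the integral. *)
have PU : (P^T <= U)%MS.
  rewrite submxE; apply/eqP; apply: trmx_inj; rewrite trmx_mul trmxK trmx0.
  rewrite -[LHS]mulmx1 -(mxintegral_mulmx mu compactG _ _ cp).
  rewrite -[RHS]mx_cst; congr mxintegral; apply/funext => g.
  rewrite mulmx1 !mulmxA [X in X *m _](_ : _ = 0) ?mul0mx//.
  apply: trmx_inj; rewrite 2!trmx_mul !trmxK trmx0 mulmxA -(mulmxA _ U).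
  by have := iU g; rewrite submxE => /eqP h; rewrite -mulmxA h mulmx0.
split; first by move=> x; exact: intertwiner_meanC.
  apply: trmx_inj; rewrite trmx_mul.
  by rewrite -{1}(mulmxKpV PU) -(mulmxA _ U) UP mulmxKpV.
by apply/eqmxP; rewrite PU -{1}UP submxMl.
Qed.

Lemma sum_rep_iso_r rho sigma phi :
  rep_iso sigma phi -> rep_iso (sum_rep rho sigma) (sum_rep rho phi).
Proof.
move=> [A [B [AB BA cA]]].
exists (block_mx 1%:M 0 0 A), (block_mx 1%:M 0 0 B).
split=> [||x] /=; rewrite !mulmx_block !(mulmx0, mul0mx, addr0, add0r, mulmx1, mul1mx).
- by rewrite AB -scalar_mx_block.
- by rewrite BA -scalar_mx_block.
- by rewrite cA.
Qed.

(** * Restriction of a representation to the image of a commuting idempotent *)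

Section Compression.
Variables (rho : representation R G) (r : nat).
Variables (C : 'M[R[i]]_(rdim rho, r)) (D : 'M[R[i]]_(r, rdim rho)).
Hypotheses (DC : D *m C = 1%:M) (cCD : forall x, rho x *m (C *m D) = C *m D *m rho x).

(** The columns of [C] are a basis of the image of the idempotent $CD$ and [D] reads off
    coordinates, so this is the restriction of [rho] to that image. *)
Let compression x := D *m rho x *m C.

Let compression1 : compression 1%g = 1%:M.
Proof. by rewrite /compression rmx1 mulmx1. Qed.

Let compressionM x y : compression (x * y)%g = compression x *m compression y.
Proof.
transitivity (D *m (rho x *m (C *m D)) *m rho y *m C); last by rewrite /compression !mulmxA.
by rewrite cCD /compression !mulmxA DC mul1mx rmxM !mulmxA.
Qed.

Let compression_continuous : mxcontinuous compression.
Proof.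
apply: mxcontinuousM; last exact: mxcontinuous_cst.
by apply: mxcontinuousM; [exact: mxcontinuous_cst|exact: rmx_mxcontinuous].
Qed.

Definition compression_rep : representation R G :=
  Representation compression1 compressionM compression_continuous.

Lemma compression_repC x : rho x *m C = C *m compression_rep x.
Proof. by rewrite /= /compression 2!mulmxA -cCD -!mulmxA DC mulmx1. Qed.

(** [C] carries a nonzero invariant subspace to one of [rho] of no larger rank; minimality makes
    that rank at least $r$. *)
Lemma compression_irreducible (U : 'M[R[i]]_(rdim rho)) :
  (0 < r)%N -> (r <= \rank U)%N ->
  (forall V, invariant_subspace (rho := rho) V -> V != 0 -> (\rank U <= \rank V)%N) ->
  irreducible compression_rep.
Proof.
move=> r0 rU minU; split=> // V iV V0.
have CD : C^T *m D^T = 1%:M by rewrite -trmx_mul DC trmx1.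
have : (\rank U <= \rank <<V *m C^T>>%MS)%N.
  apply: minU => [x|].
    rewrite genmxE (eqmxMr _ (genmxE _)) -mulmxA -trmx_mul compression_repC.
    by rewrite trmx_mul mulmxA; apply: submxMr; exact: iV.
  rewrite -mxrank_eq0 genmxE mxrank_eq0; apply: contra V0 => /eqP h.
  by rewrite -[V]mulmx1 -CD mulmxA h mul0mx.
rewrite genmxE /row_full eqn_leq rank_leq_col => /(leq_trans rU) /leq_trans; apply.
exact: mxrankM_maxl.
Qed.

End Compression.

(** In a full rank factorization $P=CD$, the factors cancel from $CDCD=CD$, leaving $DC=1$. *)
Lemma idempotent_factorization (F : fieldType) n (P : 'M[F]_n) : P *m P = P ->
  exists (C : 'M[F]_(n, \rank P)) (D : 'M[F]_(\rank P, n)),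
    C *m D = P /\ D *m C = 1%:M.
Proof.
move=> PP; exists (col_base P), (row_base P); split; first exact: mulmx_base.
have /row_fullP[B BC] := col_base_full P.
have /row_freeP[E DE] := row_base_free P.
move: BC DE (mulmx_base P); move: (col_base P) (row_base P) B E => C D B E BC DE CD.
transitivity (B *m (C *m D *m (C *m D)) *m E).
  by rewrite !mulmxA BC mul1mx -mulmxA DE mulmx1.
have -> : C *m D *m (C *m D) = C *m D by rewrite CD.
by rewrite mulmxA BC mul1mx DE.
Qed.

(** The summands are the images of $P$, an equivariant projection onto a minimal invariant subspace,
    and of $Q=1-P$. *)
Lemma irreducible_splitting rho : (0 < rdim rho)%N ->
  exists sub rest, [/\ irreducible sub, (rdim rest < rdim rho)%N &
    rep_iso rho (sum_rep sub rest)].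
Proof.
move=> d0; have [U [iU U0 minU]] := exists_minimal_invariant d0.
have [P [cP PP PU]] := exists_equivariant_projection iU.
pose Q := 1%:M - P.
have cQ x : rho x *m Q = Q *m rho x.
  by rewrite mulmxBr mulmxBl cP mulmx1 mul1mx.
have QQ : Q *m Q = Q by rewrite mulmxBr mulmx1 mulmxBl mul1mx PP subrr subr0.
have PQ : P *m Q = 0 by rewrite mulmxBr mulmx1 PP subrr.
have QP : Q *m P = 0 by rewrite mulmxBl mul1mx PP subrr.
have rP : \rank P = \rank U by rewrite -(mxrank_tr P) PU.
have rP0 : (0 < \rank P)%N by rewrite rP lt0n mxrank_eq0.
have [C [D [CD DC]]] := idempotent_factorization PP.
have [C' [D' [CD' DC']]] := idempotent_factorization QQ.
have cCD x : rho x *m (C *m D) = C *m D *m rho x by rewrite CD.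
have cCD' x : rho x *m (C' *m D') = C' *m D' *m rho x by rewrite CD'.
have DC'0 : D *m C' = 0.
  transitivity (D *m (C *m D *m (C' *m D')) *m C'); last first.
    by rewrite CD CD' PQ mulmx0 mul0mx.
  by rewrite !mulmxA DC mul1mx -mulmxA DC' mulmx1.
have D'C0 : D' *m C = 0.
  transitivity (D' *m (C' *m D' *m (C *m D)) *m C); last first.
    by rewrite CD CD' QP mulmx0 mul0mx.
  by rewrite !mulmxA DC' mul1mx -mulmxA DC mulmx1.
exists (compression_rep DC cCD), (compression_rep DC' cCD'); split.
- by apply: compression_irreducible minU; rewrite // rP.
(* $PQ=0$ bounds the sum of the two ranks by the dimension, and $P$ has positive rank. *)
- rewrite /= -subn_gt0; apply: leq_trans rP0 _.
  by rewrite leq_subRL ?rank_leq_row// addnC mulmx0_rank_max.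
- exists (row_mx C C'), (col_mx D D'); split=> [||x].
  + by rewrite mul_row_col CD CD' addrC subrK.
  + by rewrite mul_col_row DC DC' DC'0 D'C0 -scalar_mx_block.
  + rewrite mul_mx_row (compression_repC DC cCD) (compression_repC DC' cCD').
    by rewrite [RHS]mul_row_block !mulmx0 addr0 add0r.
Qed.

Lemma complete_reducibility rho : exists s : seq (representation R G),
  (forall sigma, sigma \in s -> irreducible sigma) /\ rep_iso rho (rep_bigsum s).
Proof.
have [n] := ubnP (rdim rho); elim: n rho => // n ih rho ltn.
have [d0|d0] := posnP (rdim rho).
  exists [::]; split=> //; rewrite /=.
  have e n' (A B : 'M[R[i]]_(rdim rho, n')) : A = B.
    by apply/matrixP => i j; have := ltn_ord i; rewrite [X in (_ < X)%N]d0.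
  by exists 0, 0; split=> [||x]; [exact: e|apply/matrixP => -[]|exact: e].
have [sub [rest [isub lt_rest iso]]] := irreducible_splitting d0.
have [s [irrs isos]] := ih _ (leq_trans lt_rest ltn).
exists (sub :: s); split; last exact: rep_iso_trans iso (sum_rep_iso_r _ isos).
by move=> sigma; rewrite inE => /predU1P[->|/irrs].
Qed.

(** * Multiplicities from convolutions of characters *)

Lemma rchar_bigsum (s : seq (representation R G)) x :
  rchar (rep_bigsum s) x = \sum_(sigma <- s) rchar sigma x.
Proof.
elim: s => [|sigma s ih]; first by rewrite big_nil /rchar /mxtrace big_ord0.
by rewrite big_cons -ih /rchar /= mxtrace_block.
Qed.

Lemma rchar_continuous rho : Ccontinuous (rchar rho).
Proof. by apply: Ccontinuous_trace; exact: rmx_mxcontinuous. Qed.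

(** Convolution of two characters. At $a=1$ it is their inner product, so one formula serves both
    for multiplicities and for mixed moments. *)
Definition char_conv rho sigma a :=
  Cintegral mu (fun g => rchar rho (a * g)%g * rchar sigma g^-1%g).

(** Characters add over summands, and orthogonality keeps only the isomorphic pairs. *)
Lemma char_conv_bigsum rho sigma a (s t : seq (representation R G)) :
  (forall phi, phi \in s -> irreducible phi) ->
  (forall phi, phi \in t -> irreducible phi) ->
  rep_iso rho (rep_bigsum s) -> rep_iso sigma (rep_bigsum t) ->
  char_conv rho sigma a =
  \sum_(phi <- s) (count (fun psi => `[< rep_iso psi phi >]) t)%:R *
    (rchar phi a / (rdim phi)%:R).
Proof.
move=> irrs irrt isos isot.
have cc phi psi : Ccontinuous (fun g => rchar phi (a * g)%g * rchar psi g^-1%g).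
  apply: CcontinuousM.
    apply: (@Ccontinuous_comp _ _ _ (fun x : G => (a * x)%g) (rchar phi)).
      exact: mulgl_continuous.
    exact: rchar_continuous.
  apply: (@Ccontinuous_comp _ _ _ (fun x : G => x^-1%g) (rchar psi)).
    exact: invg_continuous.
  exact: rchar_continuous.
transitivity (Cintegral mu (fun g => \sum_(phi <- s) \sum_(psi <- t)
    rchar phi (a * g)%g * rchar psi g^-1%g)).
  congr Cintegral; apply/funext => g.
  rewrite (rchar_iso isos) (rchar_iso isot) !rchar_bigsum big_distrl.
  by apply: eq_bigr => phi _; rewrite big_distrr.
rewrite Cintegral_sum//; last by move=> phi; apply: Ccontinuous_sum => psi.
apply: eq_big_seq => phi /irrs iphi; rewrite Cintegral_sum//.
rewrite -sum1_count natr_sum big_distrl [RHS]big_mkcond /=.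
apply: eq_big_seq => psi /irrt ipsi; rewrite rchar_conv//.
have -> : `[< rep_iso phi psi >] = `[< rep_iso psi phi >].
  by apply: asbool_equiv_eq; split; exact: rep_iso_sym.
by case: ifP; rewrite ?mul1r.
Qed.

Lemma sum_zero_rep_iso rho : rep_iso rho (sum_rep rho (zero_rep R G)).
Proof.
exists (row_mx 1%:M 0), (col_mx 1%:M 0); split=> [||x] /=.
- by rewrite mul_row_col mulmx1 mulmx0 addr0.
- rewrite mul_col_row !mulmx1 mulmx0 mul0mx (scalar_mx_block _ _ 1).
  by congr block_mx; apply/matrixP => -[].
- by rewrite mul_mx_row mul_row_block !(mul0mx, mulmx0, mulmx1, mul1mx, addr0).
Qed.

(** The count in any decomposition equals the inner product of the characters of [phi] and [rho],
    which does not see the decomposition; so the choice made by [xget] is immaterial. *)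
Lemma multiplicityE phi rho (s : seq (representation R G)) :
  irreducible phi -> (forall sigma, sigma \in s -> irreducible sigma) ->
  rep_iso rho (rep_bigsum s) ->
  multiplicity phi rho = count (fun sigma => `[< rep_iso sigma phi >]) s.
Proof.
move=> iphi.
have phi1 : rep_iso phi (rep_bigsum [:: phi]) by exact: sum_zero_rep_iso.
have cnt (t : seq (representation R G)) :
    (forall sigma, sigma \in t -> irreducible sigma) -> rep_iso rho (rep_bigsum t) ->
    (count (fun sigma => `[< rep_iso sigma phi >]) t)%:R = char_conv phi rho 1%g.
  move=> irrt isot.
  rewrite (@char_conv_bigsum _ _ _ [:: phi] t)//; last first.
    by move=> psi; rewrite inE => /eqP ->.
  rewrite big_seq1 /rchar rmx1 mxtrace1 divff ?mulr1//.
  by rewrite pnatr_eq0 -lt0n; case: iphi.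
move=> irrs isos; rewrite /multiplicity; set S := [set _ | _].
have : S (count (fun sigma => `[< rep_iso sigma phi >]) s) by exists s.
case: xgetP => [m _ [t [irrt isot ->]] _|/[apply]//].
by apply/eqP; rewrite -(eqr_nat R[i]) cnt// cnt.
Qed.

Lemma irreducible_iso rho sigma : rep_iso rho sigma -> irreducible rho -> irreducible sigma.
Proof.
move=> iso; have dE := rdim_iso iso; move: iso => [A [B [AB BA cA]]] [d0 irho].
split=> [|U iU U0]; first by rewrite -dE.
have BTA : B^T *m A^T = 1%:M by rewrite -trmx_mul AB trmx1.
have ATB : A^T *m B^T = 1%:M by rewrite -trmx_mul BA trmx1.
have : row_full <<U *m A^T>>%MS.
  apply: irho => [x|].
    rewrite genmxE (eqmxMr _ (genmxE _)) -mulmxA -trmx_mul cA trmx_mul mulmxA.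
    by apply: submxMr; exact: iU.
  rewrite -mxrank_eq0 genmxE mxrank_eq0; apply: contra U0 => /eqP h.
  by rewrite -[U]mulmx1 -ATB mulmxA h mul0mx.
rewrite /row_full genmxE => /eqP h; rewrite eqn_leq rank_leq_col /=.
by apply: leq_trans (mxrankM_maxl U A^T); rewrite h dE.
Qed.

Lemma Irr_irreducible phi : Irr R G phi -> irreducible phi.
Proof. by move=> [rho irho <-]; exact: irreducible_iso (iso_reprP rho) irho. Qed.

Lemma iso_repr_Irr phi rho : Irr R G phi -> rep_iso rho phi <-> iso_repr rho = phi.
Proof.
move=> [psi ipsi <-]; split=> [h|<-]; last exact: iso_reprP.
by apply/iso_repr_eq; apply: rep_iso_trans h (rep_iso_sym (iso_reprP psi)).
Qed.

(** The sum over the summands of [rho] is regrouped by isomorphism class. *)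
Lemma char_convE rho sigma a : char_conv rho sigma a =
  \sum_(phi \in Irr R G) (multiplicity phi rho)%:R * (multiplicity phi sigma)%:R *
    (rchar phi a / (rdim phi)%:R).
Proof.
have [s [irrs isos]] := complete_reducibility rho.
have [t [irrt isot]] := complete_reducibility sigma.
rewrite (char_conv_bigsum a irrs irrt isos isot).
have mE phi : Irr R G phi ->
    (multiplicity phi rho)%:R = \sum_(psi <- s) (iso_repr psi == phi)%:R :> R[i].
  move=> iphi; rewrite (multiplicityE _ irrs)//; last exact: Irr_irreducible.
  rewrite -sum1_count natr_sum big_mkcond; apply: eq_bigr => psi _.
  have -> : `[< rep_iso psi phi >] = (iso_repr psi == phi).
    by apply/asboolP/eqP => /(iso_repr_Irr psi iphi).
  by case: eqP.
(* The classes occurring in [rho], a finite list outside which the terms vanish. *)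
pose r := undup (map (@iso_repr R G) s).
have sIrr psi : psi \in s -> Irr R G (iso_repr psi) by move=> /irrs i; exists psi.
rewrite (fsbigE r) ?undup_uniq//; last 2 first.
- by move=> phi /=; rewrite mem_undup => /mapP[psi /sIrr h ->].
- move=> phi iphi; rewrite mem_undup => nphi; rewrite mE// big_seq big1 ?mul0r//.
  move=> psi ps; case: eqP => // e; case/negP: nphi.
  by rewrite -e; apply: map_f.
rewrite [RHS]big_mkcond /=.
transitivity (\sum_(phi <- r) \sum_(psi <- s) (iso_repr psi == phi)%:R *
   ((multiplicity phi sigma)%:R * (rchar phi a / (rdim phi)%:R)) : R[i]); last first.
  apply: eq_big_seq => phi; rewrite mem_undup => /mapP[psi /sIrr iphi ->].
  by rewrite mem_set// mE// -mulrA [RHS]mulr_suml.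
(* With the sums exchanged, each [psi] meets only its own class. *)
rewrite exchange_big; apply: eq_big_seq => psi ps /=.
rewrite (bigD1_seq (iso_repr psi)) ?undup_uniq ?mem_undup ?map_f//=.
rewrite eqxx mul1r big1 ?addr0 => [|phi]; last first.
  by rewrite eq_sym => /negPf ->; rewrite mul0r.
have iso := iso_reprP psi.
rewrite -(rchar_iso iso) -(rdim_iso iso); congr (_%:R * _).
rewrite (multiplicityE _ irrt isot); last exact/Irr_irreducible/sIrr.
apply: eq_count => chi; apply: asbool_equiv_eq; split=> h.
  exact: rep_iso_trans h iso.
exact: rep_iso_trans h (rep_iso_sym iso).
Qed.

End Maschke.

(** * Moments of W' - W for a fixed alpha' *)

Section Moments.
Variables (R : realType) (G : topGroupType) (mu : probability (borel G) R).
Hypotheses (compactG : compact [set: G]) (haar_mu : is_Haar mu).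
Implicit Types rho sigma phi psi tau : representation R G.

Lemma rchar_tens rho sigma x :
  rchar (tens_rep rho sigma) x = rchar rho x * rchar sigma x.
Proof.
rewrite /rchar /mxtrace mulr_sum; apply: eq_bigr => i _.
by rewrite mxE.
Qed.

Lemma rchar_tens_pow rho r x : rchar (tens_pow rho r) x = rchar rho x ^+ r.
Proof.
elim: r => [|r ih]; first by rewrite /rchar /= mxtrace1 expr0.
by rewrite exprS -ih -rchar_tens.
Qed.

Lemma rchar_conj rho x : rchar (conj_rep rho) x = (rchar rho x)^*.
Proof.
by rewrite /rchar /mxtrace rmorph_sum; apply: eq_bigr => i _; rewrite mxE.
Qed.

Lemma rchar_self_conj_sum rho x :
  rchar (self_conj_sum rho) x = rchar rho x + (rchar rho x)^*.
Proof. by rewrite -rchar_conj /rchar /= mxtrace_block. Qed.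

Lemma rchar_self_conj_sumV rho x :
  rchar (self_conj_sum rho) x^-1%g = rchar (self_conj_sum rho) x.
Proof.
rewrite !rchar_self_conj_sum (rcharV compactG haar_mu) addrC; congr (_ + _).
exact: conjCK.
Qed.

Lemma rchar_class rho h x : rchar rho (h * x * h^-1)%g = rchar rho x.
Proof. by rewrite /rchar !rmxM mxtrace_mulC mulmxA rmxV mul1mx. Qed.

Lemma rchar1 rho : rchar rho 1%g = (rdim rho)%:R.
Proof. by rewrite /rchar rmx1 mxtrace1. Qed.

(** Complex conjugation is a field automorphism, so applied entrywise it preserves inclusions and
    ranks. *)
Lemma irreducible_conj tau : irreducible tau -> irreducible (conj_rep tau).
Proof.
move=> [d0 itau]; split=> // U iU U0.
have cK n m (A : 'M[R[i]]_(n, m)) : map_mx Num.conj (map_mx Num.conj A) = A.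
  by rewrite -map_mx_comp map_mx_id// => z; exact: conjCK.
have : row_full (map_mx Num.conj U).
  apply: itau => [x|]; last by rewrite map_mx_eq0.
  by have := iU x; rewrite -(map_submx Num.conj) map_mxM -map_trmx /= cK.
by rewrite /row_full mxrank_map.
Qed.

(** Allows several sums over [Irr] to be cut down to one common list and combined termwise. *)
Lemma multiplicity_support rho : exists r : seq (representation R G),
  [/\ uniq r, [set` r] `<=` Irr R G &
    forall phi, Irr R G phi -> phi \notin r -> multiplicity phi rho = 0%N].
Proof.
have [s [irrs isos]] := complete_reducibility compactG haar_mu rho.
exists (undup (map (@iso_repr R G) s)); split; first exact: undup_uniq.
  by move=> phi /=; rewrite mem_undup => /mapP[psi /irrs h ->]; exists psi.
move=> phi iphi; rewrite mem_undup => nphi.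
rewrite (multiplicityE compactG haar_mu (Irr_irreducible iphi) irrs isos).
apply/eqP; rewrite -leqn0 leqNgt -has_count; apply/hasPn => psi ps.
apply: contra nphi => /asboolP /(iso_repr_Irr psi iphi) <-.
exact: map_f.
Qed.

Variable tau : representation R G.
Hypothesis irr_tau : irreducible tau.

Let T r := tens_pow (self_conj_sum tau) r.
Let Q r s a := char_conv mu (T r) (T s) a.
Let Y := rchar (self_conj_sum tau).
Let c := rchar tau.

(** Since [Y] is invariant under inversion, the convolution is a mixed moment of $Y(ag)$ and
    $Y(g)$. *)
Lemma char_conv_tens_pow r s a :
  Q r s a = Cintegral mu (fun g => Y (a * g)%g ^+ r * Y g ^+ s).
Proof.
congr Cintegral; apply/funext => g.
by rewrite !rchar_tens_pow rchar_self_conj_sumV.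
Qed.

Lemma W_stat_moment k a :
  Cintegral mu (fun g => ((W_stat tau (a * g)%g - W_stat tau g) ^+ k)%:C) =
  ((Num.sqrt 2)^-1%:C) ^+ k *
    \sum_(r < k.+1) (-1) ^+ (k - r) * 'C(k, r)%:R * Q r (k - r) a.
Proof.
have cY : Ccontinuous Y by exact: rchar_continuous.
have cYa : Ccontinuous (fun g => Y (a * g)%g).
  by apply: (@Ccontinuous_comp _ _ _ (fun x : G => (a * x)%g) Y) => //; exact: mulgl_continuous.
have cX r s : Ccontinuous (fun g => Y (a * g)%g ^+ r * Y g ^+ s).
  by apply: CcontinuousM; exact: CcontinuousX.
transitivity (Cintegral mu (fun g => ((Num.sqrt 2)^-1%:C) ^+ k *
    \sum_(r < k.+1) ((-1) ^+ (k - r) * 'C(k, r)%:R) *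
      (Y (a * g)%g ^+ r * Y g ^+ (k - r)))).
  congr Cintegral; apply/funext => g.
  rewrite rmorphXn rmorphB /= !W_statE -!rchar_self_conj_sum -mulrBr exprMn.
  (* [exprDn] gives the exponent $k-r$ to the first summand, which must therefore be $-Y(g)$. *)
  congr (_ * _); rewrite addrC exprDn; apply: eq_bigr => r _.
  by rewrite [in LHS]exprNn -mulr_natr -!mulrA; congr (_ * _); rewrite mulrC mulrAC mulrC.
rewrite CintegralZ//; last first.
  by apply: Ccontinuous_sum => r; apply: CcontinuousM => //; exact: Ccontinuous_cst.
congr (_ * _); rewrite Cintegral_sum//; last first.
  by move=> r; apply: CcontinuousM => //; exact: Ccontinuous_cst.
by apply: eq_bigr => r _; rewrite CintegralZ// char_conv_tens_pow.
Qed.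

(** In [char_convE] the point [a] enters only through characters. *)
Lemma char_conv_class rho sigma h a :
  char_conv mu rho sigma (h * a * h^-1)%g = char_conv mu rho sigma a.
Proof.
rewrite !(char_convE compactG haar_mu); apply: eq_fsbigr => phi _.
by rewrite rchar_class.
Qed.

Variable alpha : G.
Hypothesis alpha_self_inverse : self_inverse_class (conj_class alpha).

(** Conjugating a character value amounts to inverting its argument, and $\alpha^{-1}$ is conjugate
    to $\alpha$. *)
Lemma rchar_self_inverse rho : (rchar rho alpha)^* = rchar rho alpha.
Proof.
rewrite -(rcharV compactG haar_mu).
have [|h ->] := alpha_self_inverse (x := alpha); last exact: rchar_class.
by exists 1%g; rewrite mul1g invg1 mulg1.
Qed.

(** With $M$ the mean of $Y^4$ and $x=\chi^\tau(\alpha)/\dim\tau$, the five binomial terms add up to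
    $\frac14(2M-8xM+6Q_{22})$, where $Q_{22}$ is [Q 2 2 alpha]. *)
Lemma W_stat_moment4 :
  Cintegral mu (fun g => ((W_stat tau (alpha * g)%g - W_stat tau g) ^+ 4)%:C) =
  \sum_(phi \in Irr R G) (multiplicity phi (T 2))%:R ^+ 2 *
    (2 * (1 - c alpha / (rdim tau)%:R) -
     3 / 2 * (1 - rchar phi alpha / (rdim phi)%:R)).
Proof.
pose M := Cintegral mu (fun g => Y g ^+ 4).
have Q1 r s : (r + s = 4)%N -> Q r s 1%g = M.
  move=> rs; rewrite char_conv_tens_pow; congr Cintegral; apply/funext => g.
  by rewrite mul1g -exprD rs.
have Q04 : Q 0 4 alpha = M.
  rewrite char_conv_tens_pow; congr Cintegral; apply/funext => g.
  by rewrite expr0 mul1r.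
have Qsym r s a : Q r s a = Q s r a.
  rewrite /Q !(char_convE compactG haar_mu); apply: eq_fsbigr => phi _.
  by rewrite [X in X * _]mulrC.
have d0 : (rdim tau)%:R != 0 :> R[i] by rewrite pnatr_eq0 -lt0n; case: irr_tau.
(* The formula is compared at $\alpha$ and at $1$: both constituents of the first factor have ratio
   $x$ at $\alpha$, by reality of the character, and ratio $1$ at the identity. *)
have Q13 : Q 1 3 alpha = c alpha / (rdim tau)%:R * M.
  have [t [irrt isot]] := complete_reducibility compactG haar_mu (T 3).
  have irrs phi : phi \in [:: tau; conj_rep tau] -> irreducible phi.
    by rewrite !inE => /orP[] /eqP -> //; exact: irreducible_conj.
  have isos : rep_iso (self_conj_sum tau) (rep_bigsum [:: tau; conj_rep tau]).
    exact/sum_rep_iso_r/sum_zero_rep_iso.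
  have E a : Q 1 3 a = char_conv mu (self_conj_sum tau) (T 3) a.
    congr Cintegral; apply/funext => g.
    by rewrite [rchar (T 1) _]rchar_tens_pow expr1.
  have Ea a := char_conv_bigsum compactG haar_mu a irrs irrt isos isot.
  rewrite -(Q1 1%N 3%N)// !E !Ea !big_cons !big_nil !addr0.
  rewrite !rchar1 !divff// rchar_conj rchar_self_inverse !mulr1.
  by rewrite mulrDr ![_ * _%:R]mulrC.
have c22 : Q 2 2 alpha = \sum_(phi \in Irr R G) (multiplicity phi (T 2))%:R ^+ 2 *
    (rchar phi alpha / (rdim phi)%:R).
  by rewrite /Q (char_convE compactG haar_mu).
(* $M$ is also [Q 2 2 1], where all ratios are $1$. The factor $1$ is kept so that [restrict]
   applies. *)
have M22 : M = \sum_(phi \in Irr R G) (multiplicity phi (T 2))%:R ^+ 2 * (1 : R[i]).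
  rewrite -(Q1 2 2)%N// /Q (char_convE compactG haar_mu).
  apply: eq_fsbigr => phi /set_mem iphi.
  rewrite rchar1 divff// pnatr_eq0 -lt0n.
  by case: (Irr_irreducible iphi).
have sqrt4 : ((Num.sqrt 2)^-1%:C) ^+ 4 = 4^-1 :> R[i].
  rewrite -rmorphXn exprVn (_ : 4 = 2 * 2)%N// exprM sqr_sqrtr// fmorphV rmorphXn.
  by rewrite rmorph_nat -natrX.
rewrite W_stat_moment sqrt4 !big_ord_recr big_ord0 /=.
rewrite -[(4 - 0)%N]/4%N -[(4 - 1)%N]/3%N -[(4 - 2)%N]/2%N -[(4 - 3)%N]/1%N.
rewrite -[(4 - 4)%N]/0%N -['C(4, 0)]/1%N -['C(4, 1)]/4%N -['C(4, 2)]/6%N.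
rewrite -['C(4, 3)]/4%N -['C(4, 4)]/1%N (Qsym 3%N) (Qsym 4%N) Q04 Q13 c22 M22.
have [r [ur rIrr r0]] := multiplicity_support (T 2).
have restrict (F : representation R G -> R[i]) :
    \sum_(phi \in Irr R G) (multiplicity phi (T 2))%:R ^+ 2 * F phi =
    \sum_(phi <- r | phi \in Irr R G) (multiplicity phi (T 2))%:R ^+ 2 * F phi.
  by apply: fsbigE => // phi iphi nphi; rewrite r0// expr0n mul0r.
rewrite !restrict.
set A := \sum_(_ <- _ | _) _ * 1; set B := \sum_(_ <- _ | _) _ * (_ / _).
(* Here [A] is $M$ and [B] is $Q_{22}$; the coefficient of [A] is $\frac12-2x$. *)
transitivity ((2 * (1 - c alpha / (rdim tau)%:R) - 3 / 2) * A + 3 / 2 * B); first by field.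
rewrite !mulr_sumr -big_split; apply: eq_bigr => phi _ /=; ring.
Qed.

End Moments.

(** * Independence and Fubini *)

(** Independence makes the joint law a product measure, and Fubini reduces the expectation to the
    mean of an inner integral that is constantly [e]. *)
Lemma expectation_independent_pair (R : realType)
    (d d1 d2 : measure_display) (Omega : measurableType d)
    (T1 : measurableType d1) (T2 : measurableType d2)
    (P : probability Omega R) (X : {RV P >-> T1}) (Y : {RV P >-> T2})
    (mu : probability T1 R) (nu : probability T2 R) (F : T1 * T2 -> R) (M e : R) :
  has_law X mu -> has_law Y nu -> independent_RV X Y ->
  measurable_fun [set: T1 * T2] F -> (forall z, `|F z| <= M) ->
  (forall y, Rintegral mu [set: T1] (fun x => F (x, y)) = e) ->
  'E_P[fun w => F (X w, Y w)]%E = e%:E.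
Proof.
move=> lawX lawY indep mF FM Fe.
have mXY : measurable_fun [set: Omega] (fun w => (X w, Y w)).
  by apply: measurable_fun_pair.
pose Z : {RV P >-> (T1 * T2)%type} := mfun_Sub (mem_set mXY).
have intF : (mu \x nu)%E.-integrable [set: T1 * T2] (EFin \o F).
  exact: bounded_integrable mF FM.
rewrite unlock -[LHS](@integral_distribution _ _ _ _ _ P Z (EFin \o F)); last 2 first.
- exact/measurable_EFinP.
- by apply: bounded_integrable; [exact: measurableT_comp|move=> w; exact: FM].
transitivity (\int[mu \x nu]_z (EFin \o F) z)%E.
  apply: eq_measure_integral => A mA _; apply/esym/product_measure_unique => //.
  move=> B C mB mC; apply: etrans (indep B C mB mC) _.
  by congr (_ * _)%E; [exact: lawX|exact: lawY].
(* The order is swapped so that the inner integral runs over the first variable. *)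
rewrite -integral12_prod_meas1//= /fubini_F Fubini//.
transitivity (\int[nu]_y e%:E)%E; last first.
  by rewrite integral_cst// [X in (_ * X)%E]probability_setT mule1.
apply: eq_integral => y _; rewrite -(Fe y) fineK//.
apply: integrable_fin_num => //.
apply: bounded_integrable (fun x => FM (x, y)).
exact: measurable_fun_pair1.
Qed.

(** * Joint measurability of the translated statistic *)

Section WStatMeasurable.
Variables (R : realType) (G : topGroupType) (compactG : compact [set: G]).
Variables (tau : representation R G) (alpha : G).

Lemma W_stat_Re x :
  W_stat tau x = (Num.sqrt 2)^-1 * complex.Re (rchar (self_conj_sum tau) x).
Proof.
rewrite /W_stat -rchar_self_conj_sum.
by case: (rchar _ x) => a b /=; rewrite mul0r subr0.
Qed.

Lemma W_stat_continuous : continuous (W_stat tau).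
Proof.
move=> x; under [X in continuous_at _ X]funext do rewrite W_stat_Re.
apply: cvgM; first exact: cvg_cst.
by have [+ _] := rchar_continuous (self_conj_sum tau); apply.
Qed.

(** Expanding the trace of a product gives finite sums of products of functions of one variable.
    This yields measurability for the product sigma-algebra without comparing it with the Borel sets
    of $G\times G$. *)
Lemma W_stat_conj_measurable :
  measurable_fun [set: borel G * borel G]
    (fun z => W_stat tau ((z.2 : G) * alpha * (z.2 : G)^-1 * (z.1 : G))%g).
Proof.
pose S := self_conj_sum tau.
pose b (y : G) := (y * alpha * y^-1)%g.
have ReS i j : continuous (fun x => complex.Re (S x i j)) by have [] := @rmx_continuous _ _ S i j.
have ImS i j : continuous (fun x => complex.Im (S x i j)) by have [] := @rmx_continuous _ _ S i j.
have m1 (f : G -> R) : continuous f ->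
    measurable_fun [set: borel G * borel G] (fun z => f (z.1 : G)).
  move=> cf; apply: (measurableT_comp (f := (f : borel G -> R))) => //.
  exact: continuous_measurable_borel.
have m2 (f : G -> R) : continuous f ->
    measurable_fun [set: borel G * borel G] (fun z => f (b (z.2 : G))).
  move=> cf; apply: (measurableT_comp (f := ((f \o b) : borel G -> R))) => //.
  apply: continuous_measurable_borel => x.
  by apply: continuous_comp; [exact: conjgV_continuous|exact: cf].
have -> : (fun z : borel G * borel G => W_stat tau (b z.2 * (z.1 : G))%g) =
  (fun z => (Num.sqrt 2)^-1 * \sum_i \sum_j
     (complex.Re (S (b z.2) i j) * complex.Re (S (z.1 : G) j i) -
      complex.Im (S (b z.2) i j) * complex.Im (S (z.1 : G) j i))).
  apply/funext => z; rewrite W_stat_Re; congr (_ * _).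
  rewrite /rchar rmxM /mxtrace raddf_sum; apply: eq_bigr => i _.
  rewrite mxE raddf_sum; apply: eq_bigr => j _ /=.
  by case: (S (b z.2) i j) => ? ?; case: (S _ j i).
apply: measurable_funM; first exact: measurable_cst.
apply: measurable_sum => i; apply: measurable_sum => j.
apply: measurable_funB; apply: measurable_funM.
- exact: (m2 (fun x => complex.Re (S x i j))).
- exact: (m1 (fun x => complex.Re (S x j i))).
- exact: (m2 (fun x => complex.Im (S x i j))).
- exact: (m1 (fun x => complex.Im (S x j i))).
Qed.

End WStatMeasurable.

Theorem lemma3p18 (R : realType) (G : topGroupType)
    (compactG : compact [set: G]) (lieG : is_Lie_group R G)
    (mu : probability (borel G) R) (haar_mu : is_Haar mu)
    (tau : representation R G) (irr_tau : irreducible tau)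
    (tau_not_real : exists x : G, complex.Im (rchar tau x) != 0)
    (alpha : G) (alpha_self_inverse : self_inverse_class (conj_class alpha))
    (d : measure_display) (Omega : measurableType d) (P : probability Omega R)
    (g h : {RV P >-> borel G})
    (haar_g : has_law g mu) (haar_h : has_law h mu)
    (indep_gh : independent_RV g h) :
  let alpha' : Omega -> G := fun w => ((h w : G) * alpha * (h w : G)^-1)%g in
  let W : Omega -> R := fun w => W_stat tau (g w) in
  let W' : Omega -> R := fun w => W_stat tau (alpha' w * (g w : G))%g in
  let m (phi : representation R G) (r : nat) : R[i] :=
    (multiplicity phi (tens_pow (self_conj_sum tau) r))%:R in
  (forall k : nat, (0 < k)%N ->
     has_expectation P (fun w => (W' w - W w) ^+ k)
       (((2 `^ (k%:R / 2))^-1)%:C *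
        \sum_(r < k.+1) (-1) ^+ (k - r) * 'C(k, r)%:R *
          \sum_(phi \in Irr R G)
            m phi r * m phi (k - r)%N *
            (rchar phi alpha / (rdim phi)%:R))) /\
  has_expectation P (fun w => (W' w - W w) ^+ 4)
    (\sum_(phi \in Irr R G)
       m phi 2%N ^+ 2 *
       (2 * (1 - rchar tau alpha / (rdim tau)%:R) -
        3 / 2 * (1 - rchar phi alpha / (rdim phi)%:R))).
Proof.
move=> alpha' W W' m.
have momentE k a : (Rintegral mu [set: borel G]
      (fun x => (W_stat tau (a * (x : G))%g - W_stat tau x) ^+ k))%:C =
    ((Num.sqrt 2)^-1%:C) ^+ k * \sum_(r < k.+1) (-1) ^+ (k - r) * 'C(k, r)%:R *
      char_conv mu (tens_pow (self_conj_sum tau) r)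
        (tens_pow (self_conj_sum tau) (k - r)) a.
  by rewrite -Cintegral_real; exact: W_stat_moment.
pose E k := Rintegral mu [set: borel G]
  (fun x => (W_stat tau (alpha * (x : G))%g - W_stat tau x) ^+ k).
have [B B0 WB] := continuous_compact_bounded compactG (@W_stat_continuous _ _ tau).
have EE k : 'E_P[(fun w => (W' w - W w) ^+ k)%R]%E = (E k)%:E.
  (* [z.1] stands for [g] and [z.2] for the conjugator [h]; the bound $(2B)^k$ gives
     integrability. *)
  pose F (z : borel G * borel G) :=
    (W_stat tau ((z.2 : G) * alpha * (z.2 : G)^-1 * (z.1 : G))%g - W_stat tau z.1) ^+ k.
  apply: (@expectation_independent_pair _ _ _ _ _ _ _ P g h mu mu F ((B + B) ^+ k)) => //.
  - apply: measurable_funX; apply: measurable_funB; first exact: W_stat_conj_measurable.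
    apply: (measurableT_comp (f := (W_stat tau : borel G -> R))) => //.
    by apply: continuous_measurable_borel => x; exact: W_stat_continuous.
  - move=> z; rewrite normrX; apply: lerXn2r; rewrite ?nnegrE ?addr_ge0 ?(ltW B0)//.
    by apply: le_trans (ler_normB _ _) _; apply: lerD.
  (* For a fixed conjugator $y$ the mean over $g$ is the moment at $y\alpha y^{-1}$, equal to the
     one at $\alpha$ because the convolutions are class functions. *)
  - move=> y; apply: (@complexI R).
    rewrite [LHS](momentE k (y * alpha * y^-1)%g) [RHS]momentE; congr (_ * _).
    by apply: eq_bigr => r _; rewrite char_conv_class.
split=> [k _|]; last first.
  by exists (E 4%N); rewrite // -Cintegral_real W_stat_moment4.
exists (E k); rewrite // [LHS]momentE.
congr (_ * _); last by apply: eq_bigr => r _; rewrite char_convE.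
(* $2^{k/2}$ is read as $(2^{1/2})^k$ to match the prefactor. *)
by rewrite mulrC powRrM powR12_sqrt// powR_mulrn ?sqrtr_ge0// -rmorphXn exprVn.
Qed.
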